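(* Let $(A,m,u,\Delta,\varepsilon,\Phi)$ be a quasi-bialgebra over a field $\Bbbk$. If there exists a preantipode $S$ for $A$, then it is unique.
   Context: $\Bbbk$ is a field, $\otimes=\otimes_\Bbbk$; Sweedler notation $\Delta(a)=a_1\otimes a_2$ (summation understood). Quasi-bialgebra: $(A,m,u)$ is an associative unital $\Bbbk$-algebra, $\Delta\colon A\to A\otimes A$ and $\varepsilon\colon A\to\Bbbk$ are algebra maps, $\Phi=\Phi^1\otimes\Phi^2\otimes\Phi^3\in A\otimes A\otimes A$ is invertible, and, writing $A$ for $\mathrm{Id}_A$: $(A\otimes A\otimes\Delta)(\Phi)\cdot(\Delta\otimes A\otimes A)(\Phi)=(1\otimes\Phi)\cdot(A\otimes\Delta\otimes A)(\Phi)\cdot(\Phi\otimes1)$; $(\varepsilon\otimes A\otimes A)(\Phi)=(A\otimes\varepsilon\otimes A)(\Phi)=(A\otimes A\otimes\varepsilon)(\Phi)=1\otimes1$; $(A\otimes\Delta)(\Delta(a))\cdot\Phi=\Phi\cdot(\Delta\otimes A)(\Delta(a))$; $\varepsilon(a_1)a_2=a=a_1\varepsilon(a_2)$ for all $a\in A$. A preantipode for $A$ is a $\Bbbk$-linear map $S\colon A\to A$ such that, for all $a,b\in A$, $a_1S(ba_2)=\varepsilon(a)S(b)$, $S(a_1b)a_2=\varepsilon(a)S(b)$, and $\Phi^1S(\Phi^2)\Phi^3=1$. *)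

(* Defs.v *)
From HB Require Import structures.
From mathcomp Require Import all_boot all_algebra.
From mathcomp Require Import boolp classical_sets.
From mathcomp.multinomials Require Import freeg.

Set Implicit Arguments.
Unset Strict Implicit.
Unset Printing Implicit Defensive.

Import GRing.Theory.
Local Open Scope ring_scope.
Local Open Scope quotient_scope.

Reserved Notation "u ⊗ v" (at level 35, right associativity).

(* The tensor product of two k-vector spaces is the free k-module on U * V
   modulo the submodule generated by the bilinearity relators. *)
Section TensorSpace.
Variables (k : fieldType) (U V : lmodType k).

Inductive tensor_null : {freeg (U * V)%type / k} -> Prop :=
| TensorNull0 : tensor_null 0
| TensorNullP c x y : tensor_null x -> tensor_null y -> tensor_null (c *: x + y)
| TensorNullL c u u' v :
    tensor_null (<< (c *: u + u', v) >> - (c *: << (u, v) >> + << (u', v) >>))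
| TensorNullR c u v v' :
    tensor_null (<< (u, c *: v + v') >> - (c *: << (u, v) >> + << (u, v') >>)).

Definition tensor_ker : {pred {freeg (U * V)%type / k}} :=
  fun x => `[< tensor_null x >].

Lemma tensor_kerP x : reflect (tensor_null x) (x \in tensor_ker).
Proof. exact: asboolP. Qed.

Lemma tensor_ker_zmod : zmod_closed tensor_ker.
Proof.
split=> [|x y /tensor_kerP xN /tensor_kerP yN]; apply/tensor_kerP.
  exact: TensorNull0.
by rewrite addrC -scaleN1r; apply: TensorNullP.
Qed.

HB.instance Definition _ :=
  GRing.isZmodClosed.Build {freeg (U * V)%type / k} tensor_ker tensor_ker_zmod.

Definition tensor : Type := Quotient.quot tensor_ker.

HB.instance Definition _ := Choice.on tensor.
HB.instance Definition _ := GRing.Zmodule.on tensor.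
HB.instance Definition _ : EqQuotient _ (Quotient.equiv tensor_ker) tensor :=
  EqQuotient.on tensor.

Definition tensor_pi (x : {freeg (U * V)%type / k}) : tensor := \pi_tensor x.

Lemma tensor_pi_eq x y :
  tensor_pi x = tensor_pi y <-> tensor_null (x - y).
Proof.
rewrite /tensor_pi; split=> [/eqP|].
  by rewrite -Quotient.idealrBE => /tensor_kerP.
by move=> /tensor_kerP; rewrite Quotient.idealrBE => /eqP.
Qed.

Lemma tensor_piB x y : tensor_pi (x - y) = tensor_pi x - tensor_pi y.
Proof. exact: (raddfB (\pi_(Quotient.quot tensor_ker))). Qed.

Lemma tensor_piD x y : tensor_pi (x + y) = tensor_pi x + tensor_pi y.
Proof. exact: (raddfD (\pi_(Quotient.quot tensor_ker))). Qed.

Lemma tensor_reprK (t : tensor) : tensor_pi (repr t) = t.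
Proof. exact: reprK. Qed.

Definition tensor_scale (c : k) (t : tensor) : tensor :=
  tensor_pi (c *: repr t).

Lemma tensor_piZ c x : tensor_pi (c *: x) = tensor_scale c (tensor_pi x).
Proof.
apply/tensor_pi_eq; rewrite -scalerBr -[_ *: _]addr0.
apply: TensorNullP TensorNull0; apply/tensor_pi_eq.
by rewrite tensor_reprK.
Qed.

Lemma tensor_scaleA a b t :
  tensor_scale a (tensor_scale b t) = tensor_scale (a * b) t.
Proof. by rewrite -[t]tensor_reprK -!tensor_piZ scalerA. Qed.

Lemma tensor_scale1 : left_id 1 tensor_scale.
Proof. by move=> t; rewrite -[t]tensor_reprK -tensor_piZ scale1r. Qed.

Lemma tensor_scaleDr : right_distributive tensor_scale +%R.
Proof.
move=> a s t; rewrite -[s]tensor_reprK -[t]tensor_reprK.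
by rewrite -tensor_piD -!tensor_piZ scalerDr tensor_piD.
Qed.

Lemma tensor_scaleDl t : {morph tensor_scale^~ t : a b / a + b}.
Proof.
by move=> a b; rewrite -[t]tensor_reprK -!tensor_piZ scalerDl tensor_piD.
Qed.

HB.instance Definition _ := GRing.Zmodule_isLmodule.Build k tensor
  tensor_scaleA tensor_scale1 tensor_scaleDr tensor_scaleDl.

Lemma tensor_pi_is_linear : linear tensor_pi.
Proof. by move=> c x y; rewrite tensor_piD tensor_piZ. Qed.

HB.instance Definition _ :=
  GRing.isLinear.Build k {freeg (U * V)%type / k} tensor *:%R tensor_pi
    tensor_pi_is_linear.

Definition pure (u : U) (v : V) : tensor := tensor_pi << (u, v) >>.

End TensorSpace.

Arguments tensor {k} (U V)%_type.

Notation "U ⊗ V" := (tensor U V) : type_scope.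
Notation "u ⊗ v" := (pure u v) : ring_scope.

Notation bilinear_map f := (bilinear_for *:%R *:%R f).

Section FreegLift.
Variables (k : fieldType) (W : lmodType k) (K : choiceType) (f : K -> W).

Let lift (x : {freeg K / k}) : W := fglift f x.

Lemma fglift_is_linear : linear lift.
Proof.
have liftB : {morph lift : x y / x - y} := lift_is_additive f.
have lift0 : lift 0 = 0 by rewrite -(subrr 0) liftB subrr.
have liftN x : lift (- x) = - lift x by rewrite -[- x]add0r liftB lift0 sub0r.
have liftD x y : lift (x + y) = lift x + lift y.
  by rewrite -[y in LHS]opprK liftB liftN opprK.
have liftsum I (r : seq I) (F : I -> {freeg K / k}) :
    lift (\sum_(i <- r) F i) = \sum_(i <- r) lift (F i).
  by elim: r => [|i r IHr]; rewrite ?big_nil // !big_cons liftD IHr.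
move=> c x y; rewrite liftD; congr (_ + _).
rewrite -[in RHS](freeg_sumE x) [c *: x]/(fgscale c x) /fgscale !liftsum.
by rewrite scaler_sumr; apply: eq_bigr => i _; rewrite /lift !liftU scalerA.
Qed.

HB.instance Definition _ :=
  GRing.isLinear.Build k {freeg K / k} W *:%R (fglift f) fglift_is_linear.

End FreegLift.

Section TensorLift.
Variables (k : fieldType) (U V W : lmodType k).

(* [tensor_lift f (\sum_i u_i ⊗ v_i) = \sum_i f u_i v_i].  The value does not
   depend on the chosen representative when [f] is bilinear, see
   [tensor_lift_is_linear] and [tensor_lift_pure]; for other [f] it is
   meaningless. *)
Definition tensor_lift (f : U -> V -> W) (t : U ⊗ V) : W :=
  fglift (fun p => f p.1 p.2) (repr t).

Lemma pure_bilinear : bilinear_map (@pure k U V).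
Proof.
by split=> [v c u u'|u c v v']; rewrite /= /pure -linearP;
  apply/tensor_pi_eq; [apply: TensorNullL | apply: TensorNullR].
Qed.

Section Bilinear.
Variable f : U -> V -> W.
Hypothesis f_bil : bilinear_map f.

Local Notation ff := (fglift (fun p => f p.1 p.2)).

Let ffU u v : ff << (u, v) >> = f u v.
Proof. by rewrite liftU scale1r. Qed.

Let ff_null x : tensor_null x -> ff x = 0.
Proof.
elim=> [|c y z _ IHy _ IHz|c u u' v|c u v v'].
- exact: linear0.
- by rewrite linearP /= IHy IHz scaler0 addr0.
- by rewrite linearB linearP /= !ffU (f_bil.1 v c u u') subrr.
by rewrite linearB linearP /= !ffU (f_bil.2 u c v v') subrr.
Qed.

Let tensor_lift_pi x : tensor_lift f (tensor_pi x) = ff x.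
Proof.
apply/eqP; rewrite -subr_eq0 /tensor_lift -linearB; apply/eqP.
by apply: ff_null; apply/tensor_pi_eq; rewrite tensor_reprK.
Qed.

Lemma tensor_lift_pure u v : tensor_lift f (u ⊗ v) = f u v.
Proof. by rewrite tensor_lift_pi ffU. Qed.

Lemma tensor_lift_is_linear : linear (tensor_lift f).
Proof.
move=> c s t; rewrite -[s]tensor_reprK -[t]tensor_reprK -linearP.
by rewrite !tensor_lift_pi linearP.
Qed.

End Bilinear.

Lemma tensor_ind (P : U ⊗ V -> Prop) :
    (forall u v, P (u ⊗ v)) -> (forall s t, P s -> P t -> P (s + t)) ->
  forall t, P t.
Proof.
move=> Ppure PD t; rewrite -[t]tensor_reprK -(freeg_sumE (repr t)).
rewrite linear_sum; elim: (dom _) => [|[u v] r IHr]; rewrite ?big_nil ?big_cons.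
  have ->: 0 = (0 : U) ⊗ (0 : V).
    have := (pure_bilinear.2 (0 : U) (- 1) (0 : V) 0).
    by rewrite /= scaler0 addr0 scaleN1r addNr.
  exact: Ppure.
apply: PD => //; set c := coeff _ _.
have ->: << c *g (u, v) >> = c *: << (u, v) >> :> {freeg (U * V)%type / k}.
  by apply/eqP/freeg_eqP => z; rewrite coeffZ !coeffU mulrA mulr1.
have pZ : (c *: u) ⊗ v = c *: (u ⊗ v).
  have p0 : (0 : U) ⊗ v = 0.
    have := (pure_bilinear.1 v (- 1) (0 : U) 0).
    by rewrite /= scaler0 addr0 scaleN1r addNr.
  by have := pure_bilinear.1 v c u 0; rewrite /= !addr0 p0 addr0.
by rewrite linearZ /= -[tensor_pi _]/(u ⊗ v) -pZ; apply: Ppure.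
Qed.

Lemma eq_tensor_linear (f g : {linear (U ⊗ V)%type -> W}) :
  (forall u v, f (u ⊗ v) = g (u ⊗ v)) -> f =1 g.
Proof.
move=> fg; apply: tensor_ind => [|s t fgs fgt]; first exact: fg.
by rewrite !linearD fgs fgt.
Qed.

End TensorLift.

Section TensorMaps.
Variable k : fieldType.
Implicit Types U V W : lmodType k.

Definition tensor_map U U' V V' (f : U -> U') (g : V -> V') :
    U ⊗ V -> U' ⊗ V' :=
  tensor_lift (fun u v => f u ⊗ g v).

Definition tensor_assoc U V W : (U ⊗ V) ⊗ W -> U ⊗ V ⊗ W :=
  tensor_lift (fun s w => tensor_lift (fun u v => u ⊗ v ⊗ w) s).

Definition tensor_lunit V : (k^o ⊗ V)%type -> V :=
  tensor_lift (fun (c : k^o) v => (c : k) *: v).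

Definition tensor_runit V : (V ⊗ k^o)%type -> V :=
  tensor_lift (fun v (c : k^o) => (c : k) *: v).

Lemma tensor_lift_bilinear U V W X (f : X -> U -> V -> W) :
    (forall x, bilinear_map (f x)) ->
    forall c x x' y, (forall u v, f y u v = c *: f x u v + f x' u v) ->
  forall t, tensor_lift (f y) t = c *: tensor_lift (f x) t + tensor_lift (f x') t.
Proof.
move=> fB c x x' y fE; apply: tensor_ind => [u v|s t IHs IHt].
  by rewrite !tensor_lift_pure.
have D z : tensor_lift (f z) (s + t) = tensor_lift (f z) s + tensor_lift (f z) t.
  by have := tensor_lift_is_linear (fB z) 1 s t; rewrite !scale1r.
by rewrite !D IHs IHt scalerDr addrACA.
Qed.

Lemma pureDl U V (u u' : U) (v : V) c :
  (c *: u + u') ⊗ v = c *: (u ⊗ v) + u' ⊗ v.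
Proof. exact: ((pure_bilinear U V).1 v c u u'). Qed.

Lemma pureDr U V (u : U) (v v' : V) c :
  u ⊗ (c *: v + v') = c *: (u ⊗ v) + u ⊗ v'.
Proof. exact: ((pure_bilinear U V).2 u c v v'). Qed.

Section Map.
Variables (U U' V V' : lmodType k).
Variables (f : {linear U -> U'}) (g : {linear V -> V'}).

Let bil : bilinear_map (fun u v => f u ⊗ g v).
Proof. by split=> x c y z /=; rewrite linearP ?pureDl ?pureDr. Qed.

Lemma tensor_map_pure u v : tensor_map f g (u ⊗ v) = f u ⊗ g v.
Proof. exact: tensor_lift_pure. Qed.

Lemma tensor_map_is_linear : linear (tensor_map f g).
Proof. exact: tensor_lift_is_linear. Qed.

HB.instance Definition _ :=
  GRing.isLinear.Build k (U ⊗ V)%type (U' ⊗ V')%type *:%R (tensor_map f g)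
    tensor_map_is_linear.

End Map.

Section Assoc.
Variables U V W : lmodType k.

Let bil1 w : bilinear_map (fun (u : U) (v : V) => u ⊗ v ⊗ (w : W)).
Proof. by split=> x c y z /=; rewrite !(pureDl, pureDr). Qed.

Let bil2 : bilinear_map
  (fun s (w : W) => tensor_lift (fun (u : U) (v : V) => u ⊗ v ⊗ w) s).
Proof.
split=> [w c s t|s c w w'] /=; first exact: tensor_lift_is_linear.
apply: (tensor_lift_bilinear (f := fun w u v => u ⊗ v ⊗ w)) => // u v.
by rewrite !pureDr.
Qed.

Lemma tensor_assoc_pure (u : U) (v : V) (w : W) :
  tensor_assoc ((u ⊗ v) ⊗ w) = u ⊗ v ⊗ w.
Proof. by rewrite /tensor_assoc tensor_lift_pure // tensor_lift_pure. Qed.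

Lemma tensor_assoc_is_linear : linear (@tensor_assoc U V W).
Proof. exact: tensor_lift_is_linear. Qed.

HB.instance Definition _ :=
  GRing.isLinear.Build k ((U ⊗ V) ⊗ W)%type (U ⊗ V ⊗ W)%type *:%R
    (@tensor_assoc U V W) tensor_assoc_is_linear.

End Assoc.

Section Units.
Variable V : lmodType k.

Let lbil : bilinear_map (fun (c : k^o) (v : V) => (c : k) *: v).
Proof.
split=> [v c a b|a c v v'] /=; first by rewrite scalerDl scalerA.
by rewrite scalerDr !scalerA mulrC.
Qed.

Let rbil : bilinear_map (fun (v : V) (c : k^o) => (c : k) *: v).
Proof.
split=> [a c v v'|v c a b] /=; last by rewrite scalerDl scalerA.
by rewrite scalerDr !scalerA mulrC.
Qed.

Lemma tensor_lunit_pure (c : k^o) (v : V) : tensor_lunit (c ⊗ v) = (c : k) *: v.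
Proof. exact: tensor_lift_pure. Qed.

Lemma tensor_runit_pure (v : V) (c : k^o) : tensor_runit (v ⊗ c) = (c : k) *: v.
Proof. exact: tensor_lift_pure. Qed.

Lemma tensor_lunit_is_linear : linear (@tensor_lunit V).
Proof. exact: tensor_lift_is_linear. Qed.

Lemma tensor_runit_is_linear : linear (@tensor_runit V).
Proof. exact: tensor_lift_is_linear. Qed.

HB.instance Definition _ :=
  GRing.isLinear.Build k (k^o ⊗ V)%type V *:%R (@tensor_lunit V)
    tensor_lunit_is_linear.
HB.instance Definition _ :=
  GRing.isLinear.Build k (V ⊗ k^o)%type V *:%R (@tensor_runit V)
    tensor_runit_is_linear.

End Units.

Lemma exists_linear_form V (v : V) :
  v != 0 -> exists phi : {linear V -> k^o}, phi v = 1.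
Proof.
move=> v0.
pose P (X : set V) := (forall c x y, X x -> X y -> X (c *: x + y)) /\ ~ X v.
have [F FP Ftot|M [[Mlin MNv] Mmax]] := @Zorn_bigcup V P.
  split=> [c x y [X FX Xx] [Y FY Yy]|[X FX Xv]]; last by case: (FP X FX).
  have [XY|YX] := Ftot X Y FX FY.
    by exists Y => //; apply: (FP Y FY).1 => //; apply: XY.
  by exists X => //; apply: (FP X FX).1 => //; apply: YX.
have M0 : M 0.
  apply: contrapT => MN0; pose N x := M x \/ x = 0.
  apply: (Mmax N); first by split=> [|NM]; [left | apply/MN0/NM; right].
  split=> [c x y|[//|/eqP]]; last by rewrite (negPf v0).
  case=> [Mx|->] [My|->].
  - by left; apply: Mlin.
  - have -> : c *: x + 0 = (c - 1) *: x + x by rewrite scalerBl scale1r subrK addr0.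
    by left; apply: Mlin.
  - by left; rewrite scaler0 add0r.
  by right; rewrite scaler0 add0r.
have MZ c x : M x -> M (c *: x) by rewrite -[c *: x]addr0 => Mx; apply: Mlin.
have MB x y : M x -> M y -> M (x - y).
  by rewrite addrC -scaleN1r => Mx My; apply: Mlin.
have decomp x : exists c : k^o, M (x - (c : k) *: v).
  have [Mx|MNx] := pselect (M x); first by exists 0; rewrite scale0r subr0.
  pose N y := exists c, M (y - c *: x).
  have [Nv|NNv] := pselect (N v).
    have [c Mc] := Nv; have c0 : c != 0.
      by apply: contra_notN MNv => /eqP c0; move: Mc; rewrite c0 scale0r subr0.
    exists c^-1; have := MZ (- c^-1) _ Mc.
    by rewrite scalerBr !scaleNr scalerA mulVf // scale1r opprK addrC.
  exfalso; apply: (Mmax N); last first.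
    split=> // c y z [a Ma] [b Mb]; exists (c * a + b).
    rewrite scalerDl opprD addrACA -scalerA -scalerBr.
    exact: Mlin.
  split=> [y My|NM]; first by exists 0; rewrite scale0r subr0.
  by apply/MNx/NM; exists 1; rewrite scale1r subrr.
have decomp_uniq x (a b : k) : M (x - a *: v) -> M (x - b *: v) -> a = b.
  move=> Ma Mb; apply/eqP/negP => /negP ab; apply: MNv.
  have := MZ (b - a)^-1 _ (MB _ _ Ma Mb).
  have -> : x - a *: v - (x - b *: v) = (b - a) *: v.
    by rewrite opprB addrC subrKA scalerBl.
  rewrite scalerA mulVf ?scale1r //.
  by rewrite subr_eq0 eq_sym.
have [phi phiP] := choice decomp.
have phi_lin : linear phi.
  move=> c x y; apply: (decomp_uniq (c *: x + y)) => //.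
  rewrite scalerDl opprD addrACA -[_ *: phi x]/(c * phi x) -scalerA -scalerBr.
  exact: Mlin.
pose phiM := GRing.isLinear.Build k V k^o *:%R phi phi_lin.
pose phiL : {linear V -> k^o} := HB.pack phi phiM.
exists phiL; apply: (decomp_uniq v); first exact: phiP.
by rewrite scale1r subrr.
Qed.

Lemma pure_neq0 U V (u : U) (v : V) : u != 0 -> v != 0 -> u ⊗ v != 0.
Proof.
move=> /exists_linear_form[phi phiu] /exists_linear_form[psi psiv].
apply/eqP => /(congr1 (@tensor_lunit k^o \o tensor_map phi psi)).
rewrite linear0 /= tensor_map_pure tensor_lunit_pure phiu psiv.
by rewrite scale1r; apply/eqP/oner_neq0.
Qed.

End TensorMaps.

Section TensorAlgebra.
Variables (k : fieldType) (A B : algType k).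

Definition tensor_mul (s t : A ⊗ B) : A ⊗ B :=
  tensor_lift (fun a b => tensor_map ( *%R a) ( *%R b) t) s.

Let mapB (a : A) (b : B) :
  bilinear_map (fun a' b' => (a * a') ⊗ (b * b')).
Proof.
by split=> x c y z /=; rewrite mulrDr -scalerAr ?pureDl ?pureDr.
Qed.

Let mulB1 (t : A ⊗ B) :
  bilinear_map (fun a b => tensor_map ( *%R a) ( *%R b) t).
Proof.
split=> [b c a a'|a c b b'] /=.
  apply: (tensor_lift_bilinear (f := fun a a' b' => (a * a') ⊗ (b * b'))) => //.
  by move=> u v; rewrite mulrDl -scalerAl pureDl.
apply: (tensor_lift_bilinear (f := fun b a' b' => (a * a') ⊗ (b * b'))) => //.
by move=> u v; rewrite mulrDl -scalerAl pureDr.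
Qed.

Lemma tensor_mul_pure a b a' b' :
  tensor_mul (a ⊗ b) (a' ⊗ b') = (a * a') ⊗ (b * b').
Proof. by rewrite /tensor_mul tensor_lift_pure // /tensor_map tensor_lift_pure. Qed.

Lemma tensor_mul_bilinear : bilinear_map tensor_mul.
Proof.
split=> [t c s s'|s c t t'] /=; first exact: tensor_lift_is_linear.
apply: (tensor_lift_bilinear
  (f := fun t a b => tensor_map ( *%R a) ( *%R b) t)) => // a b.
by rewrite /tensor_map tensor_lift_is_linear.
Qed.

Let mulDl : left_distributive tensor_mul +%R.
Proof.
move=> s t r; have := tensor_mul_bilinear.1 r 1 s t.
by rewrite /= !scale1r.
Qed.

Let mulDr : right_distributive tensor_mul +%R.
Proof.
move=> r s t; have := tensor_mul_bilinear.2 r 1 s t.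
by rewrite /= !scale1r.
Qed.

Lemma tensor_mulA : associative tensor_mul.
Proof.
move=> r s t; elim/tensor_ind: r => [a b|r r' IHr IHr']; last first.
  by rewrite !mulDl IHr IHr'.
elim/tensor_ind: s => [a' b'|s s' IHs IHs']; last first.
  by rewrite !(mulDl, mulDr) IHs IHs'.
elim/tensor_ind: t => [a'' b''|t t' IHt IHt']; last first.
  by rewrite !mulDr IHt IHt'.
by rewrite !tensor_mul_pure !mulrA.
Qed.

Lemma tensor_mul1 : left_id (1 ⊗ 1) tensor_mul.
Proof.
apply: tensor_ind => [a b|s t IHs IHt]; first by rewrite tensor_mul_pure !mul1r.
by rewrite mulDr IHs IHt.
Qed.

Lemma tensor_mulr1 : right_id (1 ⊗ 1) tensor_mul.
Proof.
apply: tensor_ind => [a b|s t IHs IHt]; first by rewrite tensor_mul_pure !mulr1.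
by rewrite mulDl IHs IHt.
Qed.

Let one_neq0 : (1 : A) ⊗ (1 : B) != 0.
Proof. by apply: pure_neq0; apply: oner_neq0. Qed.

HB.instance Definition _ := GRing.Zmodule_isNzRing.Build (A ⊗ B)%type
  tensor_mulA tensor_mul1 tensor_mulr1 mulDl mulDr one_neq0.

Lemma tensor_scaleAl (c : k) (s t : A ⊗ B) : c *: (s * t) = (c *: s) * t.
Proof.
have t0 : tensor_mul 0 t = 0 by exact: (mul0r t).
have := tensor_mul_bilinear.1 t c s 0; rewrite /= t0 !addr0 => E.
exact: esym E.
Qed.

Lemma tensor_scaleAr (c : k) (s t : A ⊗ B) : c *: (s * t) = s * (c *: t).
Proof.
have s0 : tensor_mul s 0 = 0 by exact: (mulr0 s).
have := tensor_mul_bilinear.2 s c t 0; rewrite /= s0 !addr0 => E.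
exact: esym E.
Qed.

HB.instance Definition _ :=
  GRing.Lmodule_isLalgebra.Build k (A ⊗ B)%type tensor_scaleAl.
HB.instance Definition _ :=
  GRing.Lalgebra_isAlgebra.Build k (A ⊗ B)%type tensor_scaleAr.

Lemma mul_pure (a a' : A) (b b' : B) :
  (a ⊗ b) * (a' ⊗ b') = (a * a') ⊗ (b * b').
Proof. exact: tensor_mul_pure. Qed.

Lemma tensor1E : 1 = (1 : A) ⊗ (1 : B).
Proof. by []. Qed.

End TensorAlgebra.

Section Sweedler.
Variables (k : fieldType) (A : algType k).

Lemma mul_linear_mulr_bilinear (S : {linear A -> A}) b :
  bilinear_map (fun x y => x * S (b * y)).
Proof.
split=> [y c x x'|x c y y'] /=; first by rewrite mulrDl -scalerAl.
by rewrite mulrDr -scalerAr linearP mulrDr -scalerAr.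
Qed.

Lemma linear_mull_mul_bilinear (S : {linear A -> A}) b :
  bilinear_map (fun x y => S (x * b) * y).
Proof.
split=> [y c x x'|x c y y'] /=; last by rewrite mulrDr -scalerAr.
by rewrite mulrDl -scalerAl linearP mulrDl -scalerAl.
Qed.

Lemma scale_linear_bilinear (e : {linear A -> k^o}) :
  bilinear_map (fun x (y : A) => (e x : k) *: y).
Proof.
split=> [y c x x'|x c y y'] /=; first by rewrite linearP scalerDl -scalerA.
by rewrite scalerDr !scalerA mulrC.
Qed.

Lemma linear_scale_bilinear (e : {linear A -> k^o}) :
  bilinear_map (fun (x : A) y => (e y : k) *: x).
Proof.
split=> [y c x x'|x c y y'] /=; last by rewrite linearP scalerDl -scalerA.
by rewrite scalerDr !scalerA mulrC.
Qed.

Lemma mul3_bilinear (f : {linear A -> A}) x :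
  bilinear_map (fun y z => x * f y * z).
Proof.
split=> [z c y y'|y c z z'] /=; last by rewrite mulrDr -scalerAr.
by rewrite linearP mulrDr mulrDl -scalerAr -scalerAl.
Qed.

Lemma mul3_lift_bilinear (f : {linear A -> A}) :
  bilinear_map (fun x t => tensor_lift (fun y z => x * f y * z) t).
Proof.
split=> [t c x x'|x c s t] /=; last first.
  exact: (tensor_lift_is_linear (mul3_bilinear f x)).
apply: (tensor_lift_bilinear (mul3_bilinear f)) => y z.
by rewrite mulrDl mulrDl -!scalerAl.
Qed.

End Sweedler.

Section QuasiBialgebra.
Variables (k : fieldType) (A : algType k).
Variables (Delta : {lrmorphism A -> (A ⊗ A)%type}).
Variables (eps : {lrmorphism A -> k^o}).
Variables (Phi : (A ⊗ A ⊗ A)%type).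

(* [algType] imposes [1 != 0] in [A]; this is no restriction here, because
   [eps 1 = 1] already excludes the zero algebra.
   Iterated tensor products are nested to the right; the canonical maps
   [tensor_assoc], [tensor_lunit], [tensor_runit] make explicit the usual
   identifications [(U ⊗ V) ⊗ W = U ⊗ V ⊗ W], [k ⊗ V = V] and [V ⊗ k = V]. *)
Record quasi_bialgebra : Prop := QuasiBialgebra {
  reassociator_invertible : exists Psi, Phi * Psi = 1 /\ Psi * Phi = 1;
  reassociator_cocycle :
    tensor_map idfun (tensor_map idfun Delta) Phi
      * tensor_assoc (tensor_map Delta idfun Phi)
    = (1 ⊗ Phi)
      * tensor_map idfun (@tensor_assoc _ A A A \o tensor_map Delta idfun) Phi
      * tensor_map idfun (@tensor_assoc _ A A A) (tensor_assoc (Phi ⊗ 1));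
  reassociator_counitl :
    tensor_lunit (tensor_map eps idfun Phi) = (1 : A) ⊗ (1 : A);
  reassociator_counitm :
    tensor_map idfun (@tensor_lunit _ A \o tensor_map eps idfun) Phi
    = (1 : A) ⊗ (1 : A);
  reassociator_counitr :
    tensor_map idfun (@tensor_runit _ A \o tensor_map idfun eps) Phi
    = (1 : A) ⊗ (1 : A);
  quasi_coassociative : forall a,
    tensor_map idfun Delta (Delta a) * Phi
    = Phi * tensor_assoc (tensor_map Delta idfun (Delta a));
  counital_l : forall a, tensor_lift (fun a1 a2 => (eps a1 : k) *: a2) (Delta a) = a;
  counital_r : forall a, tensor_lift (fun a1 a2 => (eps a2 : k) *: a1) (Delta a) = a
}.

Record preantipode (S : {linear A -> A}) : Prop := Preantipode {
  preantipode_l : forall a b,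
    tensor_lift (fun a1 a2 => a1 * S (b * a2)) (Delta a) = (eps a : k) *: S b;
  preantipode_r : forall a b,
    tensor_lift (fun a1 a2 => S (a1 * b) * a2) (Delta a) = (eps a : k) *: S b;
  preantipode_reassociator :
    tensor_lift (fun x t => tensor_lift (fun y z => x * S y * z) t) Phi = 1
}.

End QuasiBialgebra.

(* Main.v *)
From HB Require Import structures.
Require Import Defs.
From mathcomp Require Import all_boot all_algebra.
Import GRing.Theory.
Local Open Scope ring_scope.

Set Implicit Arguments.
Unset Strict Implicit.
Unset Printing Implicit Defensive.

(** Two preantipodes [S] and [T] are compared as two inverses are in a monoid:
    one element is evaluated in two ways, once by cancelling [T] and once by
    cancelling [S].  The evaluation is the map [contract5 S T] from the fifth
    tensor power of [A] to [A],
      [x ⊗ y ⊗ z ⊗ u ⊗ v |-> x * S y * z * T u * v].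
    The axioms of a preantipode say that it absorbs coproducts in neighbouring
    legs: a coproduct multiplied from the left into the legs of [T u] and [v],
    or of [S y] and [z], may be replaced by the counit, and so may a coproduct
    multiplied from the right into the legs of [x] and [S y], or of [z] and
    [T u].

    With leg notation ([Φ_(2,3,45)] has the coproduct of its third leg spread
    over legs 4 and 5), the element is
      [l * Φ_(1,2,34) * Φ_(12,3,4)] where
      [l = Φ^-1_(2,3,45) * Φ_(3,4,5) * Φ_(2,34,5) * a_(2(34))].
    The factors [Φ_(12,3,4)] on the right and [Φ^-1_(2,3,45)] on the left are
    absorbed, then the legs of [T] cancel and [S a] remains.  On the other hand
    the pentagon in legs 1 to 4 replaces [Φ_(1,2,34) * Φ_(12,3,4)] by
    [Φ_(2,3,4) * Φ_(1,23,4) * Φ_(1,2,3)], quasi-coassociativity moves [Φ_(2,3,4)]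
    to the left of [a], and the pentagon in legs 2 to 5 turns
    [l * Φ_(2,3,4)] into [Φ_(23,4,5) * a_((23)4)]; now the coproducts over legs 2
    and 3 make the legs of [S] cancel and [T a] remains.

    The absorption rules are [contract5_comul_l] and [contract5_comul_r], the
    two final evaluations are [contract5_comul_S] and [contract5_comul_T], and
    [preantipode_unique] combines them. *)

(** * Tensor products of algebras *)

(** The type [A ⊗ A ⊗ A ⊗ A] can be read with each factor seen as a vector space
    or as an algebra, and unifying the two readings is exponential in the
    number of factors.  This constant, and the bundled algebra morphisms below,
    fix the reading as an algebra once and for all. *)
Definition atensor (k : fieldType) (A B : algType k) : algType k := (A ⊗ B)%type.

Local Notation "A ⊠ B" := (atensor A B) (at level 35, right associativity).

Definition apure (k : fieldType) (A B : algType k) (a : A) (b : B) : A ⊠ B :=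
  a ⊗ b.

Local Notation "a ⊡ b" := (apure a b) (at level 35, right associativity).

Section TensorAlgebra.
Variable k : fieldType.
Implicit Types A B C D : algType k.

Lemma apureDl A B (a a' : A) (b : B) : (a + a') ⊡ b = a ⊡ b + a' ⊡ b.
Proof. by have := pureDl a a' b 1; rewrite !scale1r. Qed.

Lemma apureDr A B (a : A) (b b' : B) : a ⊡ (b + b') = a ⊡ b + a ⊡ b'.
Proof. by have := pureDr a b b' 1; rewrite !scale1r. Qed.

Lemma mul_apure A B (a a' : A) (b b' : B) :
  (a ⊡ b) * (a' ⊡ b') = (a * a') ⊡ (b * b').
Proof. exact: mul_pure. Qed.

Lemma atensor1 A B : 1 = (1 : A) ⊡ (1 : B).
Proof. by []. Qed.

Lemma atensor_ind A B (P : A ⊠ B -> Prop) :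
    (forall a b, P (a ⊡ b)) -> (forall s t, P s -> P t -> P (s + t)) ->
  forall t, P t.
Proof. exact: tensor_ind. Qed.

Lemma atensor3_ind A B C (P : A ⊠ B ⊠ C -> Prop) :
    (forall a b c, P (a ⊡ b ⊡ c)) -> (forall s t, P s -> P t -> P (s + t)) ->
  forall t, P t.
Proof.
move=> Ppure PD; apply: atensor_ind => // a.
by apply: atensor_ind => // s t; rewrite apureDr; apply: PD.
Qed.

Lemma atensor4_ind A B C D (P : A ⊠ B ⊠ C ⊠ D -> Prop) :
    (forall a b c d, P (a ⊡ b ⊡ c ⊡ d)) ->
    (forall s t, P s -> P t -> P (s + t)) ->
  forall t, P t.
Proof.
move=> Ppure PD; apply: atensor_ind => // a.
by apply: atensor3_ind => // s t; rewrite apureDr; apply: PD.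
Qed.

Definition lrmorphism_of A B (f : A -> B) (f_lin : linear f)
    (f_mon : monoid_morphism f) : {lrmorphism A -> B} :=
  HB.pack f (GRing.isLinear.Build k A B *:%R f f_lin)
    (GRing.isMonoidMorphism.Build A B f f_mon).

(** These three instances of the general morphism rules keep [f] itself, rather
    than its image in a weaker structure, as the head of the result, so that
    they can be chained with the evaluation rules on pure tensors. *)
Lemma lrmorphismD A B (f : {lrmorphism A -> B}) s t : f (s + t) = f s + f t.
Proof. exact: linearD. Qed.

Lemma lrmorphismM A B (f : {lrmorphism A -> B}) s t : f (s * t) = f s * f t.
Proof. exact: rmorphM. Qed.

Lemma lrmorphism1 A B (f : {lrmorphism A -> B}) : f 1 = 1.
Proof. exact: rmorph1. Qed.

Lemma atensor_monoid_morphism A B C (f : {linear A ⊠ B -> C}) :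
    f (1 ⊡ 1) = 1 ->
    (forall a b a' b', f ((a * a') ⊡ (b * b')) = f (a ⊡ b) * f (a' ⊡ b')) ->
  monoid_morphism f.
Proof.
move=> f1 fM; split=> // s t; elim/atensor_ind: s => [a b|s s' IHs IHs'].
  elim/atensor_ind: t => [a' b'|t t' IHt IHt']; first by rewrite mul_apure fM.
  by rewrite mulrDr !linearD IHt IHt' mulrDr.
by rewrite mulrDl !linearD IHs IHs' mulrDl.
Qed.

Section Map.
Variables A A' B B' : algType k.

Definition lmap (f : {linear A -> A'}) (g : {linear B -> B'}) :
  {linear A ⊠ B -> A' ⊠ B'} := tensor_map f g.

Lemma lmap_pure (f : {linear A -> A'}) (g : {linear B -> B'}) a b :
  lmap f g (a ⊡ b) = f a ⊡ g b.
Proof. exact: tensor_map_pure. Qed.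

Variables (f : {lrmorphism A -> A'}) (g : {lrmorphism B -> B'}).

Lemma lmap_is_monoid_morphism : monoid_morphism (lmap f g).
Proof.
apply: atensor_monoid_morphism => [|a b a' b'].
  by rewrite lmap_pure !rmorph1.
by rewrite !lmap_pure !rmorphM mul_apure.
Qed.

Definition amap : {lrmorphism A ⊠ B -> A' ⊠ B'} :=
  lrmorphism_of (@linearP _ _ _ _ (lmap f g)) lmap_is_monoid_morphism.

Lemma amap_pure a b : amap (a ⊡ b) = f a ⊡ g b.
Proof. exact: lmap_pure. Qed.

End Map.

Section Associator.
Variables A B C : algType k.

Let lassoc : {linear (A ⊠ B) ⊠ C -> A ⊠ B ⊠ C} := @tensor_assoc k A B C.

Let lassoc_pure a b c : lassoc ((a ⊡ b) ⊡ c) = a ⊡ b ⊡ c.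
Proof. exact: tensor_assoc_pure. Qed.

Let lassoc_is_monoid_morphism : monoid_morphism lassoc.
Proof.
apply: atensor_monoid_morphism => [|s c t c']; first by rewrite !atensor1 lassoc_pure.
elim/atensor_ind: s => [a b|s s' IHs IHs']; last first.
  by rewrite mulrDl !apureDl !linearD IHs IHs' mulrDl.
elim/atensor_ind: t => [a' b'|t t' IHt IHt']; last first.
  by rewrite mulrDr !apureDl !linearD IHt IHt' mulrDr.
by rewrite mul_apure !lassoc_pure !mul_apure.
Qed.

Definition aassoc : {lrmorphism (A ⊠ B) ⊠ C -> A ⊠ B ⊠ C} :=
  lrmorphism_of (@linearP _ _ _ _ lassoc) lassoc_is_monoid_morphism.

Lemma aassoc_pure a b c : aassoc ((a ⊡ b) ⊡ c) = a ⊡ b ⊡ c.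
Proof. exact: lassoc_pure. Qed.

End Associator.

Section Units.
Variables (A B : algType k) (e : {lrmorphism A -> k^o}).

Let lcounit : {linear A ⊠ B -> B} := @tensor_lunit k B \o tensor_map e idfun.

Let lcounit_pure a b : lcounit (a ⊡ b) = (e a : k) *: b.
Proof. by rewrite /lcounit /= tensor_map_pure tensor_lunit_pure. Qed.

Let lcounit_is_monoid_morphism : monoid_morphism lcounit.
Proof.
apply: atensor_monoid_morphism => [|a b a' b']; rewrite !lcounit_pure.
  by rewrite rmorph1 scale1r.
by rewrite -scalerAl -scalerAr scalerA -rmorphM.
Qed.

Definition counitl : {lrmorphism A ⊠ B -> B} :=
  lrmorphism_of (@linearP _ _ _ _ lcounit) lcounit_is_monoid_morphism.

Lemma counitl_pure a b : counitl (a ⊡ b) = (e a : k) *: b.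
Proof. exact: lcounit_pure. Qed.

Let rcounit : {linear B ⊠ A -> B} := @tensor_runit k B \o tensor_map idfun e.

Let rcounit_pure b a : rcounit (b ⊡ a) = (e a : k) *: b.
Proof. by rewrite /rcounit /= tensor_map_pure tensor_runit_pure. Qed.

Let rcounit_is_monoid_morphism : monoid_morphism rcounit.
Proof.
apply: atensor_monoid_morphism => [|b a b' a']; rewrite !rcounit_pure.
  by rewrite rmorph1 scale1r.
by rewrite -scalerAl -scalerAr scalerA -rmorphM.
Qed.

Definition counitr : {lrmorphism B ⊠ A -> B} :=
  lrmorphism_of (@linearP _ _ _ _ rcounit) rcounit_is_monoid_morphism.

Lemma counitr_pure b a : counitr (b ⊡ a) = (e a : k) *: b.
Proof. exact: rcounit_pure. Qed.

End Units.

Section Inclusions.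
Variables A B : algType k.

Let inl_lin : linear (fun a : A => a ⊡ (1 : B)).
Proof. by move=> c a a'; apply: pureDl. Qed.

Let inl_mon : monoid_morphism (fun a : A => a ⊡ (1 : B)).
Proof. by split=> // a a'; rewrite mul_apure mulr1. Qed.

Definition ainl : {lrmorphism A -> A ⊠ B} := lrmorphism_of inl_lin inl_mon.

Lemma ainlE a : ainl a = a ⊡ 1.
Proof. by []. Qed.

Let inr_lin : linear (fun b : B => (1 : A) ⊡ b).
Proof. by move=> c b b'; apply: pureDr. Qed.

Let inr_mon : monoid_morphism (fun b : B => (1 : A) ⊡ b).
Proof. by split=> // b b'; rewrite mul_apure mulr1. Qed.

Definition ainr : {lrmorphism B -> A ⊠ B} := lrmorphism_of inr_lin inr_mon.

Lemma ainrE b : ainr b = 1 ⊡ b.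
Proof. by []. Qed.

Lemma apureE a b : a ⊡ b = ainl a * ainr b.
Proof. by rewrite mul_apure mulr1 mul1r. Qed.

Lemma apureZl (c : k) (a : A) (b : B) : (c *: a) ⊡ b = c *: (a ⊡ b).
Proof. by rewrite !apureE linearZ scalerAl. Qed.

Lemma apureZr (c : k) (a : A) (b : B) : a ⊡ (c *: b) = c *: (a ⊡ b).
Proof. by rewrite !apureE linearZ scalerAr. Qed.

End Inclusions.

Section Product.
Variable A : algType k.

Let mul_bil : bilinear_map ( *%R : A -> A -> A).
Proof.
split=> [b c a a'|a c b b'] /=; first by rewrite mulrDl -scalerAl.
by rewrite mulrDr -scalerAr.
Qed.

Definition product : {linear A ⊠ A -> A} :=
  HB.pack (tensor_lift ( *%R : A -> A -> A))
    (GRing.isLinear.Build k (A ⊠ A) A *:%R (tensor_lift ( *%R : A -> A -> A))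
      (tensor_lift_is_linear mul_bil)).

Lemma product_pure a b : product (a ⊡ b) = a * b.
Proof. exact: tensor_lift_pure mul_bil a b. Qed.

End Product.

End TensorAlgebra.

Arguments aassoc {k A B C}.
Arguments ainl {k A} B.
Arguments ainr {k} A {B}.
Arguments counitl {k A} B e.
Arguments counitr {k A} B e.
Arguments product {k A}.

(** * The contractions by one and by two linear maps *)

Section Contractions.
Variables (k : fieldType) (A : algType k).
Implicit Types S T : {linear A -> A}.

Definition contract3 T : {linear A ⊠ A ⊠ A -> A} :=
  product \o lmap idfun (product \o lmap T idfun).

Lemma contract3_pure T x y z : contract3 T (x ⊡ y ⊡ z) = x * T y * z.
Proof.
rewrite -mulrA -[LHS]/(product (lmap idfun (product \o lmap T idfun) _)).
rewrite lmap_pure product_pure; congr (_ * _).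
by rewrite -[LHS]/(product (lmap T idfun _)) lmap_pure product_pure.
Qed.

Definition contract5 S T : {linear A ⊠ A ⊠ A ⊠ A ⊠ A -> A} :=
  product \o lmap idfun (product \o lmap S (contract3 T)).

Lemma contract5_pure S T x y t :
  contract5 S T (x ⊡ y ⊡ t) = x * S y * contract3 T t.
Proof.
rewrite -mulrA -[LHS]/(product (lmap idfun (product \o lmap S (contract3 T)) _)).
rewrite lmap_pure product_pure; congr (_ * _).
by rewrite -[LHS]/(product (lmap S (contract3 T) _)) lmap_pure product_pure.
Qed.

(** The definition of [contract5] isolates the three legs of [T]; concatenation
    isolates the three legs of [S]. *)
Definition concat32 (s : A ⊠ A ⊠ A) (t : A ⊠ A) : A ⊠ A ⊠ A ⊠ A ⊠ A :=
  amap idfun aassoc (aassoc (s ⊡ t)).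

Lemma concat32_pure x y z t : concat32 (x ⊡ y ⊡ z) t = x ⊡ y ⊡ z ⊡ t.
Proof. by rewrite /concat32 aassoc_pure amap_pure aassoc_pure. Qed.

Lemma contract5_concat32 S T s u v :
  contract5 S T (concat32 s (u ⊡ v)) = contract3 S s * T u * v.
Proof.
elim/atensor3_ind: s => [x y z|s s' IHs IHs']; last first.
  by rewrite /concat32 apureDl !linearD IHs IHs' !mulrDl.
by rewrite concat32_pure contract5_pure !contract3_pure !mulrA.
Qed.

End Contractions.

(** * Legs of the tensor powers of a quasi-bialgebra *)

Section Uniqueness.
Variables (k : fieldType) (A : algType k).
Variables (Delta : {lrmorphism A -> A ⊠ A}) (eps : {lrmorphism A -> k^o}).

(** The tail [B] stays abstract, so that the same map is the coproduct of the
    first leg of [A ⊠ A] and of [A ⊠ A ⊠ A], and, under an identity, of the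
    second leg of the latter. *)
Definition comulhd (B : algType k) : {lrmorphism A ⊠ B -> A ⊠ A ⊠ B} :=
  aassoc \o amap Delta idfun.

Lemma comulhd_pure (B : algType k) a (b : B) :
  comulhd B (a ⊡ b) = aassoc (Delta a ⊡ b).
Proof. by rewrite -[LHS]/(aassoc (amap Delta idfun (a ⊡ b))) amap_pure. Qed.

Local Notation A3 := (A ⊠ A ⊠ A).
Local Notation A4 := (A ⊠ A ⊠ A ⊠ A).
(* [Di] applies the coproduct and [ei] the counit to the [i]-th leg; [snocn]
   appends [1] to a tensor with [n] legs. *)
Local Notation D1 t := (comulhd _ t).
Local Notation D2 t := (amap idfun (comulhd _) t).
Local Notation D3 t := (amap idfun (amap idfun Delta) t).
Local Notation e1 t := (counitl _ eps t).
Local Notation e2 t := (amap idfun (counitl _ eps) t).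
Local Notation e3 t := (amap idfun (counitr _ eps) t).
Local Notation snoc2 t := (amap idfun (ainl A) t).
Local Notation snoc3 t := (amap idfun (amap idfun (ainl A)) t).
Local Notation snoc4 t := (amap idfun (amap idfun (amap idfun (ainl A))) t).

Lemma aassoc_inl (B C D : algType k) (d d' : B ⊠ C) (z : D) :
  aassoc (d ⊡ z) * amap idfun (ainl D) d' = aassoc ((d * d') ⊡ z).
Proof.
have -> : amap idfun (ainl D) d' = aassoc (d' ⊡ 1).
  elim/atensor_ind: d' => [x y|s s' IHs IHs'].
    by rewrite amap_pure aassoc_pure ainlE.
  by rewrite lrmorphismD IHs IHs' apureDl lrmorphismD.
by rewrite -rmorphM mul_apure mulr1.
Qed.

Lemma snoc3E (t : A3) : snoc3 t = amap idfun aassoc (aassoc (t ⊡ 1)).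
Proof.
elim/atensor3_ind: t => [x y z|s t IHs IHt]; last first.
  by rewrite apureDl !lrmorphismD IHs IHt.
by rewrite aassoc_pure !amap_pure aassoc_pure.
Qed.

Lemma counitlE (d : A ⊠ A) :
  counitl A eps d = tensor_lift (fun a1 a2 => (eps a1 : k) *: a2) d.
Proof.
elim/atensor_ind: d => [x y|s t IHs IHt].
  by rewrite counitl_pure (tensor_lift_pure (scale_linear_bilinear eps)).
have := tensor_lift_is_linear (scale_linear_bilinear eps) 1 s t.
by rewrite lrmorphismD IHs IHt !scale1r => ->.
Qed.

Lemma counitrE (d : A ⊠ A) :
  counitr A eps d = tensor_lift (fun a1 a2 => (eps a2 : k) *: a1) d.
Proof.
elim/atensor_ind: d => [x y|s t IHs IHt].
  by rewrite counitr_pure (tensor_lift_pure (linear_scale_bilinear eps)).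
have := tensor_lift_is_linear (linear_scale_bilinear eps) 1 s t.
by rewrite lrmorphismD IHs IHt !scale1r => ->.
Qed.

Lemma comul1_snoc (d : A ⊠ A) : D1 (snoc2 d) = snoc3 (D1 d).
Proof.
elim/atensor_ind: d => [x y|s t IHs IHt]; last by rewrite !lrmorphismD IHs IHt.
rewrite !amap_pure !comulhd_pure.
elim/atensor_ind: (Delta x) => [z t|s t IHs IHt]; last first.
  by rewrite !(apureDl, lrmorphismD) IHs IHt.
by rewrite !aassoc_pure !amap_pure.
Qed.

Lemma comul2_snoc (d : A ⊠ A) : D2 (snoc2 d) = snoc3 (amap idfun Delta d).
Proof.
elim/atensor_ind: d => [x y|s t IHs IHt]; last by rewrite !lrmorphismD IHs IHt.
rewrite !amap_pure comulhd_pure; congr (_ ⊡ _).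
by rewrite -[RHS]mul1r -(lrmorphism1 aassoc) atensor1 aassoc_inl mul1r.
Qed.

Lemma counit1_snoc (d : A ⊠ A) : e1 (snoc2 d) = ainl A (counitl A eps d).
Proof.
elim/atensor_ind: d => [x y|s t IHs IHt]; last by rewrite !lrmorphismD IHs IHt.
by rewrite amap_pure !counitl_pure !ainlE apureZl.
Qed.

Lemma counit2_snoc (d : A ⊠ A) : e2 (snoc2 d) = ainl A (counitr A eps d).
Proof.
elim/atensor_ind: d => [x y|s t IHs IHt]; last by rewrite !lrmorphismD IHs IHt.
by rewrite !amap_pure counitl_pure counitr_pure !ainlE apureZl apureZr.
Qed.

(** * Absorption of coproducts by a preantipode *)

Section OnePreantipode.
Variables (Phi : A3) (T : {linear A -> A}).
Hypothesis HT : preantipode Delta eps Phi T.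

Lemma contract3_reassociator : contract3 T Phi = 1.
Proof.
rewrite -(preantipode_reassociator HT).
elim/atensor_ind: Phi => [x t|s s' IHs IHs']; last first.
  have := tensor_lift_is_linear (mul3_lift_bilinear T) 1 s s'.
  by rewrite linearD IHs IHs' !scale1r.
rewrite (tensor_lift_pure (mul3_lift_bilinear T)).
elim/atensor_ind: t => [y z|s s' IHs IHs']; last first.
  have := tensor_lift_is_linear (mul3_bilinear T x) 1 s s'.
  by rewrite apureDr linearD IHs IHs' !scale1r.
by rewrite (tensor_lift_pure (mul3_bilinear T x)) contract3_pure.
Qed.

Lemma contract3_comul_r t c z :
  contract3 T (t * aassoc (Delta c ⊡ z)) = (eps c : k) *: (contract3 T t * z).
Proof.
elim/atensor3_ind: t => [t1 t2 t3|s s' IHs IHs']; last first.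
  by rewrite mulrDl !linearD IHs IHs' mulrDl scalerDr.
rewrite contract3_pure -!mulrA scalerAr scalerAl -(preantipode_l HT).
elim/atensor_ind: (Delta c) => [x y|s s' IHs IHs']; last first.
  have := tensor_lift_is_linear (mul_linear_mulr_bilinear T t2) 1 s s'.
  rewrite !scale1r => ->.
  by rewrite apureDl linearD mulrDr linearD IHs IHs' mulrDl mulrDr.
rewrite (tensor_lift_pure (mul_linear_mulr_bilinear T t2)) aassoc_pure.
by rewrite !mul_apure contract3_pure !mulrA.
Qed.

Lemma contract3_comul_l t c x :
  contract3 T ((x ⊡ Delta c) * t) = (eps c : k) *: (x * contract3 T t).
Proof.
elim/atensor3_ind: t => [t1 t2 t3|s s' IHs IHs']; last first.
  by rewrite mulrDr !linearD IHs IHs' mulrDr scalerDr.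
rewrite contract3_pure !mulrA scalerAl (scalerAr _ (x * t1)).
rewrite -(preantipode_r HT).
elim/atensor_ind: (Delta c) => [y z|s s' IHs IHs']; last first.
  have := tensor_lift_is_linear (linear_mull_mul_bilinear T t2) 1 s s'.
  rewrite !scale1r => ->.
  by rewrite apureDr mulrDl linearD IHs IHs' mulrDr mulrDl.
rewrite (tensor_lift_pure (linear_mull_mul_bilinear T t2)).
by rewrite !mul_apure contract3_pure !mulrA.
Qed.

End OnePreantipode.

(** * Uniqueness *)

Section TwoPreantipodes.
Variables (Phi : A3) (S T : {linear A -> A}).
Hypotheses (HS : preantipode Delta eps Phi S) (HT : preantipode Delta eps Phi T).

(** The coproduct of the last leg of [q] lies over the legs of [T u] and [v],
    where [T] absorbs it. *)
Lemma contract5_comul_l (q : A3) (l r : A4) :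
  contract5 S T (ainr A (D3 q * l) * snoc4 r)
  = contract5 S T (ainr A (snoc3 (snoc2 (e3 q)) * l) * snoc4 r).
Proof.
elim/atensor3_ind: q => [q1 q2 q3|t t' IHt IHt']; last first.
  by rewrite !(lrmorphismD, linearD, mulrDl) IHt IHt'.
elim/atensor_ind: l => [l1 l|t t' IHt IHt']; last first.
  by rewrite !(lrmorphismD, linearD, mulrDl, mulrDr) IHt IHt'.
elim/atensor4_ind: r => [r1 r2 r3 r4|t t' IHt IHt']; last first.
  by rewrite !(lrmorphismD, linearD, mulrDr) IHt IHt'.
rewrite !amap_pure counitr_pure !ainlE !ainrE !mul_apure.
rewrite !contract5_pure; congr (_ * _).
rewrite -!mulrA (contract3_comul_l HT).
have -> : (1 : A) ⊡ (1 : A) = Delta 1 by rewrite rmorph1.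
by rewrite (contract3_comul_l HT) rmorph1 scale1r scalerAl.
Qed.

(** The coproduct of the first leg of [p] lies over the legs of [x] and [S y],
    where [S] absorbs it. *)
Lemma contract5_comul_r (l s : A4) (p : A3) :
  contract5 S T (ainr A l * snoc4 (s * D1 p))
  = contract5 S T (ainr A l * snoc4 (s * ainr A (ainr A (e1 p)))).
Proof.
elim/atensor3_ind: p => [p1 p2 p3|t t' IHt IHt']; last first.
  by rewrite !(lrmorphismD, linearD, mulrDr) IHt IHt'.
elim/atensor4_ind: s => [s1 s2 s3 s4|t t' IHt IHt']; last first.
  by rewrite !(mulrDl, lrmorphismD, linearD, mulrDr) IHt IHt'.
elim/atensor4_ind: l => [l1 l2 l3 l4|t t' IHt IHt']; last first.
  by rewrite !(lrmorphismD, linearD, mulrDl) IHt IHt'.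
have key d y2 : ainr A (l1 ⊡ l2 ⊡ l3 ⊡ l4)
      * snoc4 ((s1 ⊡ s2 ⊡ s3 ⊡ s4) * aassoc (d ⊡ y2 ⊡ p3))
    = concat32 ((s1 ⊡ (l1 * s2) ⊡ (l2 * s3)) * aassoc (d ⊡ y2))
        ((l3 * (s4 * p3)) ⊡ l4).
  elim/atensor_ind: d => [x y|t t' IHt IHt']; last first.
    rewrite !apureDl !(lrmorphismD, linearD, mulrDr) IHt IHt'.
    by rewrite /concat32 !apureDl !lrmorphismD.
  rewrite !aassoc_pure !mul_apure concat32_pure !amap_pure ainlE ainrE.
  by rewrite !mul_apure mul1r mulr1 -!mulrA.
rewrite comulhd_pure key.
have -> : ainr A (ainr A (e1 (p1 ⊡ p2 ⊡ p3)))
    = aassoc (Delta 1 ⊡ ((eps p1 : k) *: p2) ⊡ p3).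
  by rewrite counitl_pure -apureZl rmorph1 !atensor1 aassoc_pure.
rewrite key !contract5_concat32 !(contract3_comul_r HS) contract3_pure.
by rewrite rmorph1 scale1r -scalerAr -!scalerAl.
Qed.

(** The second leg of [q] and the third of [p] multiply to the coproduct of one
    element, which [T] absorbs; the legs of [T] then only see the reassociator
    and contribute [1]. *)
Lemma contract5_comul_S (q p : A3) :
  contract5 S T (ainr A (ainr A Phi * D2 q) * snoc4 (D3 p))
  = contract3 S (ainr A (e2 q) * snoc2 (e3 p)).
Proof.
elim/atensor3_ind: q => [q1 q2 q3|t t' IHt IHt']; last first.
  by rewrite !(lrmorphismD, linearD, mulrDl, mulrDr) IHt IHt'.
elim/atensor3_ind: p => [p1 p2 p3|t t' IHt IHt']; last first.
  by rewrite !(lrmorphismD, linearD, mulrDr) IHt IHt'.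
rewrite !amap_pure counitr_pure counitl_pure !ainlE !ainrE !comulhd_pure.
rewrite !mul_apure contract5_pure contract3_pure -[Phi * _ * _]mulrA.
rewrite aassoc_inl -rmorphM.
rewrite (contract3_comul_r HT) (contract3_reassociator HT).
rewrite !mul1r !mulr1 rmorphM -!scalerAr linearZ -scalerAr -!scalerAl.
by rewrite scalerA.
Qed.

(** The mirror image: the first leg of [q] and the second of [p] multiply to a
    coproduct over the legs of [S y] and [z], which [S] absorbs, leaving [1]. *)
Lemma contract5_comul_T (q p : A3) :
  contract5 S T (ainr A (D1 q) * snoc4 (D2 p * snoc3 Phi))
  = contract3 T (ainr A (e1 q) * snoc2 (e2 p)).
Proof.
elim/atensor3_ind: q => [q1 q2 q3|t t' IHt IHt']; last first.
  by rewrite !(lrmorphismD, linearD, mulrDl, mulrDr) IHt IHt'.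
elim/atensor3_ind: p => [p1 p2 p3|t t' IHt IHt']; last first.
  by rewrite !(lrmorphismD, linearD, mulrDl, mulrDr) IHt IHt'.
have key d d' X : ainr A (aassoc (d ⊡ q2 ⊡ q3))
      * snoc4 ((p1 ⊡ aassoc (d' ⊡ p3)) * snoc3 X)
    = concat32 ((p1 ⊡ (d * d')) * X) ((q2 * p3) ⊡ q3).
  elim/atensor3_ind: X => [x y z|t t' IHt IHt']; last first.
    rewrite !(lrmorphismD, mulrDr) IHt IHt'.
    by rewrite /concat32 apureDl !lrmorphismD.
  elim/atensor_ind: d => [d1 d2|t t' IHt IHt']; last first.
    rewrite !(apureDl, apureDr, lrmorphismD, mulrDl) IHt IHt'.
    by rewrite /concat32 apureDl !lrmorphismD.
  elim/atensor_ind: d' => [d3 d4|t t' IHt IHt']; last first.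
    rewrite !(apureDl, apureDr, lrmorphismD, mulrDl, mulrDr) IHt IHt'.
    by rewrite /concat32 apureDl !lrmorphismD.
  rewrite !aassoc_pure !amap_pure !mul_apure concat32_pure !amap_pure.
  by rewrite ainrE !mul_apure !mul1r !mulr1 -!mulrA.
rewrite comulhd_pure amap_pure comulhd_pure key -rmorphM contract5_concat32.
rewrite (contract3_comul_l HS) (contract3_reassociator HS).
rewrite counitl_pure amap_pure counitl_pure amap_pure ainlE ainrE -apureZl.
rewrite !mul_apure contract3_pure !mul1r !mulr1 rmorphM.
rewrite -!scalerAr -!scalerAl linearZ /= linearZ /= -!scalerAr -!scalerAl.
rewrite scalerA.
by congr (_ *: _); apply: (@mulrC k).
Qed.

Lemma preantipode_unique (Psi : A3) :
    Psi * Phi = 1 ->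
    D3 Phi * D1 Phi = ainr A Phi * D2 Phi * snoc3 Phi ->
    e1 Phi = 1 -> e2 Phi = 1 -> e3 Phi = 1 ->
    (forall a, amap idfun Delta (Delta a) * Phi = Phi * D1 (Delta a)) ->
    (forall a, counitl A eps (Delta a) = a) ->
    (forall a, counitr A eps (Delta a) = a) ->
  S =1 T.
Proof.
move=> PsiPhi pentagon e1Phi e2Phi e3Phi coassoc counitall counitalr a.
(* [l] occupies legs 2 to 5; [q] brings in [a], the only argument left once
   the legs of one of the two maps have cancelled. *)
pose q := Phi * snoc2 (Delta a).
pose l := D3 Psi * (ainr A Phi * D2 q).
(* The pentagon in legs 2 to 5. *)
have lPhi : l * snoc3 Phi = D1 q.
  have D2q : D2 q = D2 Phi * snoc3 (amap idfun Delta (Delta a)).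
    by rewrite lrmorphismM comul2_snoc.
  have D1q : D1 q = D1 Phi * snoc3 (D1 (Delta a)).
    by rewrite lrmorphismM comul1_snoc.
  have snoc3_coassoc := congr1 (fun t => snoc3 t) (coassoc a).
  rewrite !lrmorphismM in snoc3_coassoc.
  have D3Psi := congr1 (fun t => D3 t) PsiPhi.
  rewrite lrmorphismM lrmorphism1 in D3Psi.
  have cancel (R : algType k) (x y z u v w p r : R) :
      v * w = w * r -> x * p = 1 -> p * y = z * u * w ->
    x * (z * (u * v)) * w = y * r.
    move=> vw xp py; rewrite -[y]mul1r -xp -[x * p * y]mulrA py -!mulrA.
    by rewrite -vw.
  rewrite D1q /l D2q; exact: cancel snoc3_coassoc D3Psi pentagon.
have e3Psi : e3 Psi = 1.
  have := congr1 (fun t => e3 t) PsiPhi.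
  by rewrite lrmorphismM lrmorphism1 e3Phi mulr1.
(* The two sides of the pentagon in legs 1 to 4. *)
have lhs : contract5 S T (ainr A l * snoc4 (D3 Phi * D1 Phi)) = S a.
  rewrite contract5_comul_r e1Phi !lrmorphism1 mulr1.
  rewrite contract5_comul_l e3Psi !lrmorphism1 mul1r contract5_comul_S.
  rewrite e3Phi lrmorphism1 mulr1 lrmorphismM e2Phi mul1r counit2_snoc.
  by rewrite counitalr ainlE ainrE contract3_pure mul1r mulr1.
have rhs :
    contract5 S T (ainr A l * snoc4 (ainr A Phi * D2 Phi * snoc3 Phi)) = T a.
  have -> : ainr A l * snoc4 (ainr A Phi * D2 Phi * snoc3 Phi)
      = ainr A (D1 q) * snoc4 (D2 Phi * snoc3 Phi).
    have shift : snoc4 (ainr A Phi) = ainr A (snoc3 Phi).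
      by rewrite !ainrE amap_pure.
    by rewrite -lPhi !lrmorphismM shift !mulrA.
  rewrite contract5_comul_T e2Phi lrmorphism1 mulr1 lrmorphismM e1Phi mul1r.
  by rewrite counit1_snoc counitall ainlE ainrE contract3_pure mul1r mulr1.
by rewrite -lhs -rhs pentagon.
Qed.

End TwoPreantipodes.

End Uniqueness.

Theorem theorem3p16 (k : fieldType) (A : algType k)
    (Delta : {lrmorphism A -> (A ⊗ A)%type})
    (eps : {lrmorphism A -> k^o})
    (Phi : (A ⊗ A ⊗ A)%type)
    (HA : quasi_bialgebra Delta eps Phi)
    (S T : {linear A -> A})
    (HS : preantipode Delta eps Phi S)
    (HT : preantipode Delta eps Phi T) :
  S =1 T.
Proof.
case: HA => [[Psi [_ PsiPhi]]] pentagon ul um ur coassoc cl cr.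
have {}pentagon :
    amap idfun (amap idfun Delta) Phi * comulhd Delta _ Phi
    = ainr A Phi * amap idfun (comulhd Delta _) Phi
      * amap idfun (amap idfun (ainl A)) Phi.
  by rewrite snoc3E; exact: pentagon.
apply: (@preantipode_unique k A Delta eps Phi S T HS HT Psi) => // a.
  by rewrite counitlE; exact: cl.
by rewrite counitrE; exact: cr.
Qed.
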